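(* Let $q\ge1$ and $k\ge0$ be integers and let $N_{q,k}$ be the pseudofractal scale-free web after $k$ iterations. Its Kemeny's constant $K(N_{q,k})$, multiplicative degree-Kirchhoff index $\hat{\mathcal K}(N_{q,k})$, additive degree-Kirchhoff index $\bar{\mathcal K}(N_{q,k})$ and Kirchhoff index $\mathcal K(N_{q,k})$ are $$K(N_{q,k})=\frac{3(2q+3)(2q+1)^{k-1}}{2}-\frac{q+4}{2q+1}\Big(\frac{4q+2}{q+2}\Big)^k+\frac{4q+5}{6(2q+1)},$$ $$\hat{\mathcal K}(N_{q,k})=\frac{9(2q+3)}{2q+1}(2q+1)^{2k}-\frac{6(q+4)}{2q+1}\Big(\frac{2(2q+1)^2}{q+2}\Big)^k+(4q+5)(2q+1)^{k-1},$$ $$\bar{\mathcal K}(N_{q,k})=\frac{9(2q+3)(6q+11)}{4(2q+1)(2q+5)}(2q+1)^{2k}-\frac{3(q+4)}{2q+1}\Big(\frac{2(2q+1)^2}{q+2}\Big)^k+\frac{3(q+4)}{2q+5}\Big(\frac{2(2q+1)}{q+2}\Big)^k+\frac{4q+5}{2}(2q+1)^{k-1}+\frac14,$$ $$\begin{aligned}\mathcal K(N_{q,k})=&\frac{9(2q+3)^2}{8(2q+1)(2q+5)}(2q+1)^{2k}-\frac{3(q+4)}{8(2q+1)}\Big(\frac{2(2q+1)^2}{q+2}\Big)^k+\frac{3(q+4)}{4(2q+5)}\Big(\frac{2(2q+1)}{q+2}\Big)^k\\&+\frac{(q+1)(4q+5)}{2(2q+5)}(2q+1)^{k-1}+\f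rac{5(q+4)}{8(2q+5)}\Big(\frac{2}{q+2}\Big)^k-\frac18.\end{aligned}$$
   Context: For a positive integer $q$, the $q$-triangulation graph $R_q(G)$ of a simple connected graph $G$ is obtained from $G$ by keeping all nodes and edges of $G$ and adding, for each edge $uv$ of $G$, $q$ disjoint paths of length $2$: $ux_1v,\dots,ux_qv$, where $x_1,\dots,x_q$ are new nodes. The pseudofractal scale-free webs are defined by: $N_{q,0}$ is the complete graph on 3 nodes, and $N_{q,k}=R_q(N_{q,k-1})$ for $k\ge1$. For a simple connected graph $G$ with $m$ edges and degrees $d_i$: the simple unbiased random walk moves from $i$ to each neighbor with probability $1/d_i$; its stationary distribution is $\pi_i=d_i/2m$; $T_{ij}$ is the expected number of steps to first reach $j$ from $i$ ($T_{ii}=0$); Kemeny's constant is $K(G)=\sum_j\pi_jT_{ij}$, which is independent of $i$ and equals $\sum_{i\ge2}\frac1{1-\lambda_i}$, where $1=\lambda_1>\lambda_2\ge\cdots$ are the eigenvalues of $D^{-1/2}AD^{-1/2}$ ($A$ adjacency matrix, $D$ diagonal degree matrix). The resistance distance $r_{ij}$ is the effective resistance between $i$ and $j$ when every edge is replaced by a unit resistor. With sums over unordered pairs of distinct nodes, $\mathcal K(G)=\sum_{\{i,j\}}r_{ij}$ (Kirchhoff index), $\bar{\mathcal K}(G)=\sum_{\{i,j\}}(d_i+d_j)r_{ij}$ (additive degree-Kirchhoff index), $\hat{\mathcal K}(G)=\sum_{\{i,j\}}d_id_jr_{ij}$ (multiplicative degree-Kirchhoff index). *)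

(* Defs.v *)
From HB Require Import structures.
From mathcomp Require Import all_boot all_order all_algebra.
From mathcomp Require Import all_classical all_reals all_analysis.

Set Implicit Arguments.
Unset Strict Implicit.
Unset Printing Implicit Defensive.

Import Order.TTheory GRing.Theory Num.Theory.
Import numFieldNormedType.Exports.

Local Open Scope ring_scope.

Record sgraph := SGraph {
  vertex :> finType;
  adj : rel vertex;
  adj_sym : symmetric adj;
  adj_irrefl : irreflexive adj }.

Definition edges (G : sgraph) : {set {set G}} :=
  [set e | [exists u : G, exists v : G, adj u v && (e == [set u; v])]].

Definition edge (G : sgraph) : finType := {e : {set G} | e \in edges G}.

Definition degree (G : sgraph) (x : G) : nat := #|[set y | adj x y]|.

Section Complete.
Variable n : nat.

Definition complete_adj : rel 'I_n := fun x y => x != y.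

Lemma complete_adj_sym : symmetric complete_adj.
Proof. by move=> x y; rewrite /complete_adj eq_sym. Qed.

Lemma complete_adj_irrefl : irreflexive complete_adj.
Proof. by move=> x; rewrite /complete_adj eqxx. Qed.

Definition complete_graph : sgraph :=
  SGraph complete_adj_sym complete_adj_irrefl.

End Complete.

Section Triangulation.
Variables (q : nat) (G : sgraph).

(* [inl u] is an old node; [inr (e, i)] is the middle node of the i-th path of
   length 2 added for the edge e. *)
Definition triangulation_vertex : finType := (G + edge G * 'I_q)%type.

Definition triangulation_adj : rel triangulation_vertex := fun a b =>
  match a, b with
  | inl u, inl v => adj u v
  | inl u, inr (e, _) => u \in val e
  | inr (e, _), inl u => u \in val e
  | inr _, inr _ => false
  end.

Lemma triangulation_adj_sym : symmetric triangulation_adj.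
Proof. by move=> [u|[e i]] [v|[f j]] //=; exact: adj_sym. Qed.

Lemma triangulation_adj_irrefl : irreflexive triangulation_adj.
Proof. by move=> [u|[e i]] //=; exact: adj_irrefl. Qed.

Definition triangulation : sgraph :=
  SGraph triangulation_adj_sym triangulation_adj_irrefl.

End Triangulation.

Definition pseudofractal_web (q k : nat) : sgraph :=
  iter k (triangulation q) (complete_graph 3).

Section RandomWalk.
Variables (R : realType) (G : sgraph).

Definition transition (x y : G) : R :=
  if adj x y then (degree x)%:R^-1 else 0.

Definition stationary (x : G) : R :=
  (degree x)%:R / (2 * #|edges G|)%:R.

(* Probability that the walk started at x visits the nodes of s in its first
   [size s] steps. *)
Fixpoint walk_prob (x : G) (s : seq G) : R :=
  if s is y :: s' then transition x y * walk_prob y s' else 1.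

(* Probability that the walk started at i is at j for the first time after
   exactly n steps. *)
Definition first_hit_prob (i j : G) (n : nat) : R :=
  \sum_(s : n.-tuple G | (last i s == j) && (j \notin belast i s))
    walk_prob i s.

Local Open Scope ereal_scope.

(* Expectation of the {0, 1, ..., +oo}-valued hitting time. The second term
   accounts for the event that j is never reached; it vanishes when that event
   has probability 0, because 0 * +oo = 0 in \bar R. *)
Definition hitting_time (i j : G) : \bar R :=
  \sum_(0 <= n <oo) (n%:R * first_hit_prob i j n)%:E
  + (1 - \sum_(0 <= n <oo) (first_hit_prob i j n)%:E) * +oo.

(* The dependence on the starting node i is only apparent when G is
   connected. *)
Definition kemeny (i : G) : \bar R :=
  \sum_(j : G) (stationary j)%:E * hitting_time i j.

End RandomWalk.

Section Resistance.
Variables (R : realType) (G : sgraph).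

(* Node potentials when a unit current enters the network at i and leaves it
   at j: with unit resistors the current from x to a neighbor y is v x - v y
   (Ohm), and the net current out of x is prescribed (Kirchhoff). *)
Definition unit_current_potential (i j : G) (v : G -> R) : Prop :=
  forall x : G,
    \sum_(y : G | adj x y) (v x - v y) = (x == i)%:R - (x == j)%:R.

(* The resulting potential difference, which is uniquely determined when G is
   connected; the default 0 is only used when there is no such potential. *)
Definition resistance (i j : G) : R :=
  xget 0 [set r | exists2 v, unit_current_potential i j v & r = v i - v j].

(* Each unordered pair of distinct nodes is counted once, the nodes being
   listed in the order of enum_rank. *)
Definition pair_sum (F : G -> G -> R) : R :=
  \sum_(i : G) \sum_(j : G | (enum_rank i < enum_rank j)%N) F i j.

Definition kirchhoff : R := pair_sum resistance.

Definition additive_kirchhoff : R :=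
  pair_sum (fun i j => (degree i + degree j)%:R * resistance i j).

Definition multiplicative_kirchhoff : R :=
  pair_sum (fun i j => (degree i * degree j)%:R * resistance i j).

End Resistance.

(* Main.v *)
Require Import Defs.
From mathcomp Require Import all_boot all_order all_algebra.
From mathcomp Require Import all_classical all_reals all_analysis.
From mathcomp Require Import ring lra.

Set Implicit Arguments.
Unset Strict Implicit.
Unset Printing Implicit Defensive.

Import Order.TTheory GRing.Theory Num.Theory.
Import numFieldNormedType.Exports.

Local Open Scope ring_scope.

(** The proof rests on one equation that recognizes the resistances of a graph:
a symmetric matrix rho with zero diagonal is the resistance matrix as soon as,
for the graph Laplacian L acting on the first argument,
  L (rho (., j)) x = c x - 2 [x = j]
for some function c that does not depend on j ([resistance_matrix]).  Indeed
(rho (., j) - rho (., i)) / 2 is then a unit current potential from i to j,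
and the self-adjointness of L turns the same equation into the uniqueness of
potentials up to a constant, which is how connectedness enters
([harmonic_const], [resistance_matrixE]).  Summing the equation over x gives Foster's theorem:
the resistances of the edges add up to the number of nodes minus 1 ([foster]).

The equation also gives the hitting times.  The function
  h i = 1/2 sum_k d_k (rho i j + rho j k - rho i k)
vanishes at j and satisfies L h = d elsewhere, that is h i = 1 + the mean of h
over the neighbors of i.  Iterating this relation along the walk killed at j
writes h as a partial sum of the expected hitting time plus remainders that
decay geometrically, so h i is the expected hitting time ([hitting_timeE]).
Averaging over the stationary distribution leaves
  K = (multiplicative degree-Kirchhoff index) / (2 m)    ([kemeny_kirchhoff]).

For the triangulation graph a candidate matrix is written down explicitly: an
edge in parallel with q paths of length 2 has resistance a = 2 / (q + 2), so
the old resistances are multiplied by a; and the resistance between a midpoint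
and another node is the mean of those between its two ends and that node, up
to an offset.  The candidate satisfies the equation
([triangulation_resistanceP]), hence is the resistance matrix.  Because the
entries at a midpoint come from means over the ends of its edge, a weighted sum of resistances over the new graph is a weighted sum over the old
graph, where every midpoint has given half of its weight to each end, plus
terms that only involve total weights and total offsets ([weighted_sum_triangulation]).  With Foster's theorem this makes the sums of
rho, d_x rho and d_x d_y rho satisfy a triangular linear recursion
([triangulation_sums]).  The closed forms are polynomials in
X = (2 q + 1)^k and Y = (2 / (q + 2))^k; one iteration multiplies X by 2 q + 1
and Y by 2 / (q + 2), which turns the recursion into identities of rational
functions ([web_indices]). *)

(** * The Laplacian and the equation of resistance matrices *)

Lemma degree_sum1 (R : realType) (G : sgraph) (x : G) :
  (degree x)%:R = \sum_(y | adj x y) (1 : R).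
Proof. by rewrite /degree sumr_const cardsE. Qed.

Lemma sum_delta (R : pzSemiRingType) (I : finType) (f : I -> R) (j : I) :
  \sum_i f i * (i == j)%:R = f j.
Proof.
rewrite (bigD1 j) //= eqxx mulr1 big1 ?addr0 // => i /negbTE ->.
by rewrite mulr0.
Qed.

Lemma sum_adj_exchange (R : realType) (G : sgraph) (F : G -> G -> R) :
  \sum_x \sum_(y | adj x y) F x y = \sum_x \sum_(y | adj x y) F y x.
Proof.
rewrite (exchange_big_dep xpredT) //=.
by apply: eq_bigr => x _; apply: eq_bigl => y; rewrite adj_sym.
Qed.

Section Laplacian.
Variables (R : realType) (G : sgraph).
Implicit Types (v w : G -> R) (x y : G).

Definition laplacian v x : R := \sum_(y | adj x y) (v x - v y).

Lemma laplacianE v x :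
  laplacian v x = (degree x)%:R * v x - \sum_(y | adj x y) v y.
Proof.
rewrite /laplacian sumrB degree_sum1 mulr_suml.
by congr (_ - _); apply: eq_bigr => y _; rewrite mul1r.
Qed.

Lemma laplacian_self_adjoint v w :
  \sum_x w x * laplacian v x = \sum_x laplacian w x * v x.
Proof.
under eq_bigr => x _ do rewrite laplacianE mulrBr mulr_sumr.
under [RHS]eq_bigr => x _ do rewrite laplacianE mulrBl mulr_suml.
rewrite !sumrB; congr (_ - _); last by rewrite sum_adj_exchange.
by apply: eq_bigr => x _; ring.
Qed.

Lemma sum_laplacian v : \sum_x laplacian v x = 0.
Proof.
have := laplacian_self_adjoint v (fun=> 1).
under eq_bigr => x _ do rewrite mul1r.
move=> ->; apply: big1 => x _.
by rewrite /laplacian big1 ?mul0r // => y _; rewrite subrr.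
Qed.

(** The same function c serves all columns, so the difference of columns j and
i has Laplacian 2 [x = i] - 2 [x = j]: it is twice a unit current potential. *)
Definition resistance_matrix (rho : G -> G -> R) : Prop :=
  [/\ forall x y, rho x y = rho y x,
      forall x, rho x x = 0
    & exists c : G -> R, forall x j,
        laplacian (rho^~ j) x = c x - 2 * (x == j)%:R].

Variable rho : G -> G -> R.
Hypothesis rhoP : resistance_matrix rho.

Lemma sum_resistance_source c :
  (forall x j, laplacian (rho^~ j) x = c x - 2 * (x == j)%:R) ->
  G -> \sum_x c x = 2.
Proof.
move=> cP j; have := sum_laplacian (rho^~ j).
under eq_bigr => x _ do rewrite cP.
by rewrite sumrB (sum_delta (fun=> 2)); lra.
Qed.

(** Pairing v with column i of rho and moving the Laplacian to v, which it
kills, gives sum_x v x * c x = 2 v i, whose left side does not depend on i. *)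
Lemma harmonic_const v : (forall x, laplacian v x = 0) ->
  forall i j, v i = v j.
Proof.
move=> v0; have [_ _ [c cP]] := rhoP.
suff E i : \sum_x v x * c x = 2 * v i.
  by move=> i j; apply: (@mulfI _ 2); rewrite ?pnatr_eq0 // -!E.
have := laplacian_self_adjoint (rho^~ i) v.
rewrite [RHS]big1; last by move=> x _; rewrite v0 mul0r.
under eq_bigr => x _ do rewrite cP mulrBr mulrA.
by rewrite sumrB sum_delta; lra.
Qed.

Lemma resistance_matrixE i j : resistance R i j = rho i j.
Proof.
have [rhoC rho0 [c cP]] := rhoP.
have ucP : unit_current_potential i j (fun x => (rho x j - rho x i) / 2).
  move=> x; transitivity ((laplacian (rho^~ j) x - laplacian (rho^~ i) x) / 2).
    rewrite /laplacian -sumrB mulr_suml; apply: eq_bigr => y _; lra.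
  by rewrite !cP; lra.
rewrite /resistance; apply: xget_subset1.
  exists (fun x => (rho x j - rho x i) / 2) => //.
  by rewrite !rho0 (rhoC j i); lra.
move=> r s [v vP ->] [w wP ->].
have /harmonic_const/(_ i j) : forall x, laplacian (fun x => v x - w x) x = 0.
  move=> x; transitivity (laplacian v x - laplacian w x).
    by rewrite /laplacian -sumrB; apply: eq_bigr => y _; ring.
  by rewrite /laplacian vP wP subrr.
by move=> /=; lra.
Qed.

(** Each edge is counted twice in the sum.  The diagonal case j = x of the
equation says that the resistances of the edges at x add up to 2 - c x, and the
sum of c is 2. *)
Lemma foster : G -> \sum_x \sum_(y | adj x y) rho x y = 2 * (#|G|%:R - 1).
Proof.
move=> i; have [rhoC rho0 [c cP]] := rhoP.
have E x : \sum_(y | adj x y) rho x y = 2 - c x.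
  have := cP x x; rewrite eqxx laplacianE rho0 mulr1 mulr0 sub0r.
  by under eq_bigr => y _ do rewrite (rhoC y x); lra.
under eq_bigr => x _ do rewrite E.
rewrite sumrB (sum_resistance_source cP i) sumr_const.
by rewrite -[_ *+ _]mulr_natr; ring.
Qed.

(** At an isolated node x the Laplacian vanishes, so the equation would give
c x = 2 from column x and c x = 0 from column y. *)
Lemma degree_gt0 x y : x != y -> (0 < degree x)%N.
Proof.
move=> xy; rewrite lt0n; apply/negP => /eqP dx.
have [_ _ [c cP]] := rhoP.
have L0 v : laplacian v x = 0.
  rewrite /laplacian big_pred0 // => z; apply/negP => xz.
  by have := card0_eq dx z; rewrite !inE xz.
have := cP x x; have := cP x y.
by rewrite !L0 eqxx (negbTE xy) /=; lra.
Qed.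

(** This is the expected hitting time of j from i, in the resistance form due
to Tetali. *)
Definition resistance_hitting_time (i j : G) : R :=
  2^-1 * \sum_k (degree k)%:R * (rho i j + rho j k - rho i k).

Lemma laplacian_hitting_time i j : i != j ->
  laplacian (resistance_hitting_time^~ j) i = (degree i)%:R.
Proof.
move=> ij; have [_ _ [c cP]] := rhoP.
transitivity (2^-1 * \sum_k (degree k)%:R *
    (laplacian (rho^~ j) i - laplacian (rho^~ k) i)).
  rewrite /laplacian /resistance_hitting_time.
  under eq_bigr => y _ do rewrite -mulrBr -sumrB.
  rewrite -mulr_sumr exchange_big /=; congr (_ * _).
  apply: eq_bigr => k _; rewrite -sumrB mulr_sumr.
  by apply: eq_bigr => y _; ring.
rewrite (bigD1 i) //= !cP (negbTE ij) eqxx big1 => [|k ki]; first by move=> /=; lra.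
by rewrite cP (eq_sym i) (negbTE ki) /=; ring.
Qed.

Lemma hitting_time0 j : resistance_hitting_time j j = 0.
Proof.
have [_ rho0 _] := rhoP.
by rewrite /resistance_hitting_time big1 ?mulr0 // => k _; rewrite rho0; ring.
Qed.

(** Minimum principle: at a minimum other than j the Laplacian would be
nonpositive, although it equals the degree. *)
Lemma hitting_time_ge0 i j : 0 <= resistance_hitting_time i j.
Proof.
pose x := [arg min_(x < j) resistance_hitting_time x j]%O.
have xmin y : resistance_hitting_time x j <= resistance_hitting_time y j.
  by rewrite /x; case: arg_minP => // z _; apply.
have [xj|xj] := eqVneq x j; first by rewrite -(hitting_time0 j) -{1}xj.
have : laplacian (resistance_hitting_time^~ j) x <= 0.
  by apply: sumr_le0 => y _; rewrite subr_le0.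
by rewrite laplacian_hitting_time // leNgt ltr0n (degree_gt0 xj).
Qed.

End Laplacian.

(** * Hitting times of the random walk *)

Lemma sum_tuple_cons (V : nmodType) (T : finType) n (P : pred (seq T))
    (F : seq T -> V) :
  \sum_(s : n.+1.-tuple T | P s) F s =
  \sum_y \sum_(t : n.-tuple T | P (y :: t)) F (y :: t).
Proof.
rewrite pair_big_dep /=.
rewrite (reindex (fun p : T * n.-tuple T => cons_tuple p.1 p.2)) //=.
exists (fun s : n.+1.-tuple T => (thead s, behead_tuple s)).
  by move=> [y t] _ /=; congr pair; apply: val_inj.
by move=> s _; apply: val_inj => /=; rewrite [in RHS](tuple_eta s).
Qed.

(** With t the square root of x, n t^n is at most 1 + t + ... + t^(n-1), hence
at most 1 / (1 - t); the other factor t^n tends to 0. *)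
Lemma cvg_natM_expr0 (R : realType) (x : R) : 0 <= x < 1 ->
  ((fun n : nat => n%:R * x ^+ n) @ \oo --> (0 : R))%classic.
Proof.
move=> /andP[x0 x1]; pose t := Num.sqrt x.
have t0 : 0 <= t by exact: sqrtr_ge0.
have tt : t ^+ 2 = x by rewrite sqr_sqrtr.
have t1 : t < 1 by rewrite -(ltr_pXn2r (n := 2)) ?nnegrE ?expr1n ?tt.
have bound n : n%:R * t ^+ n * (1 - t) <= 1 - t ^+ n.
  elim: n => [|n IHn]; first by rewrite expr0 !mul0r subrr.
  have tn1 : t ^+ n.+1 <= 1 by rewrite exprn_ile1 // ltW.
  have tn0 : 0 <= t ^+ n.+1 by rewrite exprn_ge0.
  have : t * (n%:R * t ^+ n * (1 - t)) <= t * (1 - t ^+ n) by rewrite ler_wpM2l.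
  have : 0 <= (1 - t) * (1 - t ^+ n.+1) by rewrite mulr_ge0; lra.
  rewrite -natr1 !exprS; lra.
apply: (@squeeze_cvgr _ _ _ _ (fun=> 0) (geometric (1 - t)^-1 t)).
- near=> n; rewrite mulr_ge0 ?ler0n ?exprn_ge0 //=.
  rewrite -tt -exprM mulnC exprM expr2 mulrA ler_wpM2r ?exprn_ge0 //.
  rewrite -[leRHS]mul1r ler_pdivlMr ?subr_gt0 //.
  by apply: le_trans (bound n) _; rewrite gerBl exprn_ge0.
- exact: cvg_cst.
- by apply: cvg_geometric; rewrite ger0_norm.
Unshelve. all: by end_near. Qed.

Lemma nneseries_EFin (R : realType) (u : nat -> R) (l : R) :
  ((fun n => \sum_(0 <= m < n) u m) @ \oo --> l)%classic ->
  (\sum_(0 <= n <oo) (u n)%:E = l%:E)%E.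
Proof.
move=> ul.
rewrite -(cvg_lim (@Rhausdorff R) ul) -EFin_lim; last by apply: cvgP ul.
by congr (limn _)%classic; apply: funext => n /=; rewrite sumEFin.
Qed.

Section HittingTime.
Variables (R : realType) (G : sgraph) (j : G).
Implicit Types (f h : G -> R) (i y : G).

(** The transition operator of the walk killed when it is at j. *)
Definition killed_step f i : R :=
  (i != j)%:R * \sum_y transition R i y * f y.

Lemma first_hit_prob0 i : first_hit_prob R i j 0 = (i == j)%:R.
Proof.
rewrite /first_hit_prob big_mkcond (big_pred1 [tuple]) /=.
  by rewrite andbT; case: eqP.
by move=> t; apply/esym/eqP; exact: tuple0.
Qed.

Lemma first_hit_probS i n :
  first_hit_prob R i j n.+1 = killed_step (fun y => first_hit_prob R y j n) i.
Proof.
rewrite /first_hit_prob /killed_step.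
rewrite (@sum_tuple_cons _ _ n (fun s => (last i s == j) && (j \notin belast i s))
          (walk_prob R i)) /= mulr_sumr.
apply: eq_bigr => y _; rewrite -mulr_sumr mulrCA; congr (_ * _).
rewrite big_mkcond [X in _ * X]big_mkcond mulr_sumr /=.
apply: eq_bigr => t _; rewrite in_cons negb_or [j == i]eq_sym.
by case: (i == j); rewrite ?andbF ?mul0r ?mul1r.
Qed.

Lemma killed_stepD f h i :
  killed_step (fun y => f y + h y) i = killed_step f i + killed_step h i.
Proof.
rewrite /killed_step -mulrDr -big_split; congr (_ * _).
by apply: eq_bigr => y _; rewrite mulrDr.
Qed.

Lemma killed_stepZ c f i :
  killed_step (fun y => c * f y) i = c * killed_step f i.
Proof.
rewrite /killed_step [RHS]mulrCA; congr (_ * _); rewrite mulr_sumr.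
by apply: eq_bigr => y _; rewrite mulrCA.
Qed.

Lemma killed_step_sum N (F : nat -> G -> R) i :
  killed_step (fun y => \sum_(0 <= n < N) F n y) i =
  \sum_(0 <= n < N) killed_step (F n) i.
Proof.
rewrite /killed_step -[RHS]mulr_sumr [in RHS]exchange_big /=; congr (_ * _).
by apply: eq_bigr => y _; rewrite mulr_sumr.
Qed.

Lemma le_killed_step f h i : (forall y, f y <= h y) ->
  killed_step f i <= killed_step h i.
Proof.
move=> fh; rewrite ler_wpM2l ?ler0n // ler_sum // => y _.
by rewrite ler_wpM2l // /transition; case: ifP => // _; rewrite invr_ge0 ler0n.
Qed.

Lemma le_iter_killed_step n f h i : (forall y, f y <= h y) ->
  iter n killed_step f i <= iter n killed_step h i.
Proof.
by move=> fh; elim: n i => //= n IHn i; apply: le_killed_step.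
Qed.

Lemma sum_transition f i :
  \sum_y transition R i y * f y = (degree i)%:R^-1 * \sum_(y | adj i y) f y.
Proof.
rewrite mulr_sumr [RHS]big_mkcond; apply: eq_bigr => y _.
by rewrite /transition; case: ifP; rewrite ?mul0r.
Qed.

Hypothesis deg_gt0 : forall i, i != j -> (0 < degree i)%N.

Lemma killed_step1 i : killed_step (fun=> 1) i = (i != j)%:R.
Proof.
rewrite /killed_step; have [//|ij] := eqVneq i j; first by rewrite mul0r.
by rewrite mul1r sum_transition -degree_sum1 mulVf // pnatr_eq0 -lt0n deg_gt0.
Qed.

(** The last term is the probability that j is not reached before time N. *)
Lemma first_hit_total N i :
  \sum_(0 <= n < N) first_hit_prob R i j n
  + iter N killed_step (fun=> 1) i = 1.
Proof.
elim: N i => [|N IHN] i; first by rewrite big_nil add0r.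
rewrite big_nat_recl // first_hit_prob0 iterS.
under eq_bigr => n _ do rewrite first_hit_probS.
rewrite -killed_step_sum -addrA -killed_stepD.
rewrite [X in killed_step X](_ : _ = fun=> 1); last exact/funext.
by rewrite killed_step1 -natrD; case: (i == j).
Qed.

Variable h : G -> R.
Hypotheses (h_ge0 : forall i, 0 <= h i) (hj : h j = 0).
Hypothesis lap_h : forall i, i != j -> laplacian h i = (degree i)%:R.

Lemma killed_step_succ i : killed_step (fun y => 1 + h y) i = h i.
Proof.
rewrite killed_stepD killed_step1 /killed_step.
have [->|ij] := eqVneq i j; first by rewrite hj mul0r addr0.
have di : (degree i)%:R != 0 :> R by rewrite pnatr_eq0 -lt0n deg_gt0.
have := lap_h ij; rewrite laplacianE sum_transition mul1r => E.
apply: (mulfI di); rewrite mulrDr mulVKf // mulr1; lra.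
Qed.

(** The remainders are those of the expectation stopped at time N: the N steps
already made and the value h of the steps to come, both on the event that j is
not reached before time N. *)
Lemma first_hit_mean N i :
  \sum_(0 <= n < N) n%:R * first_hit_prob R i j n
  + N%:R * iter N killed_step (fun=> 1) i + iter N killed_step h i = h i.
Proof.
elim: N i => [|N IHN] i; first by rewrite big_nil mul0r !add0r.
rewrite big_nat_recl // mul0r add0r !iterS -killed_stepZ.
under eq_bigr => n _ do rewrite first_hit_probS -killed_stepZ.
rewrite -killed_step_sum -!killed_stepD.
rewrite [X in killed_step X](_ : _ = fun y => 1 + h y) ?killed_step_succ //.
apply/funext => y; have := IHN y; have := first_hit_total N y.
under [in X in _ -> _ -> X]eq_bigr => n _ do rewrite -natr1 mulrDl mul1r.
by rewrite big_split -natr1 /=; lra.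
Qed.

(** Since 1 + h is at most M, the step 1 + h |-> h loses at least the fraction
1 / M, so theta is a contraction rate for the killed walk. *)
Let M : R := 1 + \sum_i h i.
Let theta : R := 1 - M^-1.

Lemma succ_le_bound i : 1 + h i <= M.
Proof.
by rewrite lerD2l (bigD1 i) //= lerDl sumr_ge0.
Qed.

Lemma bound_ge1 : 1 <= M.
Proof. by rewrite lerDl sumr_ge0. Qed.

Lemma theta_bounds : 0 <= theta < 1.
Proof.
have M1 := bound_ge1; have M0 : 0 < M by lra.
by rewrite /theta subr_ge0 invf_le1 // M1 gtrBl invr_gt0.
Qed.

Lemma iter_killed_step_bound N i :
  iter N killed_step (fun y => 1 + h y) i <= M * theta ^+ N.
Proof.
have M1 := bound_ge1; have M0 : 0 < M by lra.
have /andP[th0 th1] := theta_bounds.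
suff : iter N killed_step (fun y => 1 + h y) i <= theta ^+ N * (1 + h i).
  move=> /le_trans; apply; rewrite mulrC ler_wpM2r ?exprn_ge0 //.
  exact: succ_le_bound.
elim: N i => [|N IHN] i; first by rewrite mul1r.
rewrite iterS; apply: le_trans (le_killed_step _ IHN) _.
rewrite killed_stepZ killed_step_succ exprSr -mulrA ler_wpM2l ?exprn_ge0 //.
have := succ_le_bound i; rewrite -[leRHS]mul1r -ler_pdivrMr // => Hi.
by rewrite /theta mulrBl mul1r (mulrC M^-1); lra.
Qed.

Lemma hitting_timeE i : hitting_time R i j = (h i)%:E.
Proof.
have /andP[th0 th1] := theta_bounds.
have th : `|theta| < 1 by rewrite ger0_norm.
have iter0 f : (forall y, 0 <= f y) -> forall n, 0 <= iter n killed_step f i.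
  move=> f0 n; have E : iter n killed_step (fun=> 0) i = 0.
    elim: n (i) => //= n IHn x; rewrite /killed_step big1 ?mulr0 // => y _.
    by rewrite IHn mulr0.
  by rewrite -E; apply: le_iter_killed_step.
have s0 n : 0 <= iter n killed_step (fun=> 1) i by apply: iter0.
have g0 n : 0 <= iter n killed_step h i by apply: iter0.
have sM n : iter n killed_step (fun=> 1) i <= M * theta ^+ n.
  apply: le_trans (iter_killed_step_bound n i).
  by apply: le_iter_killed_step => y; rewrite lerDl.
have gM n : iter n killed_step h i <= M * theta ^+ n.
  apply: le_trans (iter_killed_step_bound n i).
  by apply: le_iter_killed_step => y; rewrite lerDr.
have cM : ((fun n => M * theta ^+ n) @ \oo --> 0)%classic by exact: cvg_geometric.
have cs : ((fun n => iter n killed_step (fun=> 1) i) @ \oo --> 0)%classic.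
  apply: squeeze_cvgr (cvg_cst 0) cM.
  by near=> n; rewrite s0 sM.
have cg : ((fun n => iter n killed_step h i) @ \oo --> 0)%classic.
  apply: squeeze_cvgr (cvg_cst 0) cM.
  by near=> n; rewrite g0 gM.
have cns : ((fun n => n%:R * iter n killed_step (fun=> 1) i) @ \oo --> 0)%classic.
  have cnM : ((fun n => M * (n%:R * theta ^+ n)) @ \oo --> 0)%classic.
    rewrite -(mulr0 M); apply: cvgMr; apply: cvg_natM_expr0.
    exact: theta_bounds.
  apply: squeeze_cvgr (cvg_cst 0) cnM.
  by near=> n; rewrite mulr_ge0 ?ler0n //= mulrCA ler_wpM2l ?ler0n.
have mean : (\sum_(0 <= n <oo) (n%:R * first_hit_prob R i j n)%:E = (h i)%:E)%E.
  apply: nneseries_EFin; rewrite [X in (X @ _)%classic](_ : _ = fun N =>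
    h i - N%:R * iter N killed_step (fun=> 1) i - iter N killed_step h i).
    rewrite -[X in (_ --> X)%classic]subr0; apply: cvgB => //.
    by rewrite -[X in (_ --> X)%classic]subr0; apply: cvgB => //; exact: cvg_cst.
  by apply/funext => N; rewrite -(first_hit_mean N i); ring.
have total : (\sum_(0 <= n <oo) (first_hit_prob R i j n)%:E = 1%:E)%E.
  apply: nneseries_EFin; rewrite [X in (X @ _)%classic]
    (_ : _ = fun N => 1 - iter N killed_step (fun=> 1) i).
    by rewrite -[X in (_ --> X)%classic]subr0; apply: cvgB => //; exact: cvg_cst.
  by apply/funext => N; have := first_hit_total N i; lra.
by rewrite /hitting_time mean total subee // mul0e adde0.
Unshelve. all: by end_near. Qed.

End HittingTime.

(** * Sums over edges *)

Section Edges.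
Variables (R : realType) (G : sgraph).
Implicit Types (u v x : G) (e : edge G).

Lemma edge_ends e : exists u v, u != v /\ val e = [set u; v].
Proof.
case: e => e /=; rewrite inE => /existsP[u /existsP[v /andP[uv /eqP ->]]].
by exists u, v; split => //; apply/eqP => uvE; rewrite uvE adj_irrefl in uv.
Qed.

Lemma sum_incident (F : {set G} -> R) x :
  \sum_(e : edge G | x \in val e) F (val e) = \sum_(y | adj x y) F [set x; y].
Proof.
rewrite -(big_sub_cond (mem (edges G)) (fun A : {set G} => x \in A) F).
rewrite (eq_bigl [in [set e in edges G | x \in e]]); last first.
  by move=> e; rewrite !inE.
have -> : [set e in edges G | x \in e]
    = [set [set x; y] | y in [set y | adj x y]].
  apply/setP => e; rewrite !inE; apply/andP/imsetP.
  - case=> /existsP[u /existsP[v /andP[uv /eqP ->]]].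
    rewrite !inE => /orP[] /eqP xE; [exists v|exists u]; rewrite ?inE xE //.
      by rewrite adj_sym.
    by rewrite finset.setUC.
  - case=> y; rewrite inE => xy ->; rewrite !inE eqxx; split => //.
    by apply/existsP; exists x; apply/existsP; exists y; rewrite xy eqxx.
rewrite big_imset /=; first by apply: eq_bigl => y; rewrite inE.
move=> y z; rewrite !inE => xy xz /setP /(_ y); rewrite !inE eqxx orbT.
case: (y =P x) xy => [-> |_ _ /esym/eqP //]; by rewrite adj_irrefl.
Qed.

Lemma sum_edge_ends (f : G -> R) :
  \sum_(e : edge G) \sum_(u in val e) f u = \sum_u (degree u)%:R * f u.
Proof.
rewrite (exchange_big_dep xpredT) //=; apply: eq_bigr => u _.
rewrite (sum_incident (fun=> f u)) degree_sum1 mulr_suml.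
by apply: eq_bigr => y _; rewrite mul1r.
Qed.

Lemma sum_edge_const e (c : R) : \sum_(u in val e) c = 2 * c.
Proof.
by have [u [v [uv ->]]] := edge_ends e; rewrite sumr_const cards2 uv mulr_natl.
Qed.

Lemma card_edge : #|edge G| = #|edges G|.
Proof. by rewrite card_sig; apply: eq_card. Qed.

Lemma handshake : \sum_(u : G) (degree u)%:R = 2 * #|edges G|%:R :> R.
Proof.
have := sum_edge_ends (fun=> 1).
under eq_bigr => e _ do rewrite sum_edge_const.
rewrite sumr_const card_edge mulr1 mulr_natr => ->.
by apply: eq_bigr => u _; rewrite mulr1.
Qed.

(** On a set that is an edge this is the mean over its two ends. *)
Definition edge_mean (f : G -> R) (e : {set G}) : R := 2^-1 * \sum_(u in e) f u.

Lemma edge_mean_affine e (b c : R) (f : G -> R) :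
  edge_mean (fun u => b * f u + c) (val e) = b * edge_mean f (val e) + c.
Proof.
by rewrite /edge_mean big_split /= sum_edge_const -mulr_sumr; lra.
Qed.

(** An edge with ends x and y contributes rho x y / 2 to the left side, because
its four pairs of ends include the two diagonal ones. *)
Lemma sum_edge_mean2 (rho : G -> G -> R) :
    (forall x y, rho x y = rho y x) -> (forall x, rho x x = 0) ->
  \sum_(e : edge G) edge_mean (fun u => edge_mean (rho u) (val e)) (val e)
  = 4^-1 * \sum_x \sum_(y | adj x y) rho x y.
Proof.
move=> rhoC rho0; rewrite /edge_mean -mulr_sumr (exchange_big_dep xpredT) //=.
have -> : 4^-1 = 2^-1 * 2^-1 :> R by lra.
rewrite -[RHS]mulrA; congr (_ * _); rewrite mulr_sumr; apply: eq_bigr => x _.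
rewrite -mulr_sumr; congr (_ * _).
rewrite (sum_incident (fun A : {set G} => \sum_(u in A) rho x u)).
apply: eq_bigr => y xy; rewrite big_setU1 /=; last first.
  by rewrite inE; apply/eqP => xyE; rewrite xyE adj_irrefl in xy.
by rewrite big_set1 rho0 add0r.
Qed.

End Edges.

(** * Kemeny's constant as a resistance sum *)

(** In the sum over j and k the two terms that contain i cancel each other,
which is why the starting node disappears. *)
Lemma kemenyE (R : realType) (G : sgraph) (rho : G -> G -> R) (i : G) :
  resistance_matrix rho ->
  kemeny R i = ((\sum_x \sum_y (degree x)%:R * (degree y)%:R * rho x y)
                / (4 * #|edges G|%:R))%:E.
Proof.
move=> rhoP.
have hitE j : hitting_time R i j = (resistance_hitting_time rho i j)%:E.
  apply: (@hitting_timeE _ _ _ _ (fun x => resistance_hitting_time rho x j)).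
  - by move=> x; exact: (degree_gt0 rhoP).
  - by move=> x; exact: hitting_time_ge0.
  - exact: hitting_time0.
  - by move=> x; exact: laplacian_hitting_time.
rewrite /kemeny; under eq_bigr => j _ do rewrite hitE -EFinM.
rewrite sumEFin; congr (_%:E); rewrite /stationary natrM.
set m := #|edges G|%:R; pose d (x : G) : R := (degree x)%:R.
transitivity ((2 * m)^-1 * 2^-1 *
  (\sum_j d j * \sum_k d k * (rho i j + rho j k - rho i k))).
  rewrite mulr_sumr; apply: eq_bigr => j _; rewrite /resistance_hitting_time /d; ring.
rewrite -invfM mulrC -[2 * m * 2]mulrAC -natrM; congr (_ / _).
transitivity (\sum_j \sum_k (d k * (d j * rho i j) + d j * d k * rho j k
                - d j * (d k * rho i k))).
  by apply: eq_bigr => j _; rewrite mulr_sumr; apply: eq_bigr => k _; ring.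
under eq_bigr => j _ do rewrite sumrB big_split /=.
rewrite sumrB big_split /= [X in X + _ - _]exchange_big /=.
by rewrite addrC addKr.
Qed.

(** * Resistances of the triangulation graph *)

Definition weighted_sum (R : realType) (G : sgraph) (rho : G -> G -> R)
    (w1 w2 : G -> R) : R :=
  \sum_x \sum_y w1 x * w2 y * rho x y.

Section Triangulation.
Variables (R : realType) (q : nat) (G : sgraph).
Let T := triangulation q G.
Let Q : R := q%:R.

Lemma sum_triangulation (P : pred T) (F : T -> R) :
  \sum_(x : T | P x) F x =
  \sum_(u : G | P (inl u)) F (inl u)
  + \sum_(e : edge G) \sum_(i < q | P (inr (e, i))) F (inr (e, i)).
Proof.
rewrite [LHS](big_sumType _ P F) /=; congr (_ + _).
by rewrite pair_big_dep; apply: eq_big => -[].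
Qed.

Lemma sum_triangulation_old (F : T -> R) (u : G) :
  \sum_(x : T | adj (inl u : T) x) F x =
  \sum_(v | adj u v) F (inl v)
  + \sum_(e : edge G | u \in val e) \sum_(i < q) F (inr (e, i)).
Proof.
rewrite sum_triangulation; congr (_ + _).
rewrite [RHS]big_mkcond; apply: eq_bigr => e _ /=.
by case: ifP => ue; [apply: eq_bigl | apply: big_pred0].
Qed.

Lemma sum_triangulation_new (F : T -> R) (e : edge G) i :
  \sum_(x : T | adj (inr (e, i) : T) x) F x = \sum_(u in val e) F (inl u).
Proof.
by rewrite sum_triangulation [X in _ + X]big1 ?addr0 // => f _; apply: big_pred0.
Qed.

Lemma degree_old u : (degree (inl u : T))%:R = (Q + 1) * (degree u)%:R :> R.
Proof.
rewrite degree_sum1 sum_triangulation_old.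
under [X in _ + X]eq_bigr => e _ do rewrite sumr_const card_ord.
by rewrite (sum_incident (fun=> 1 *+ q)) sumrMnl degree_sum1 -[_ *+ q]mulr_natr; ring.
Qed.

Lemma degree_new e i : (degree (inr (e, i) : T))%:R = 2 :> R.
Proof. by rewrite degree_sum1 sum_triangulation_new sum_edge_const mulr1. Qed.

Lemma card_triangulation : #|T|%:R = #|G|%:R + Q * #|edges G|%:R :> R.
Proof.
by rewrite [#|T|]card_sum card_prod card_ord card_edge natrD natrM mulrC.
Qed.

Lemma card_edges_triangulation :
  #|edges T|%:R = (2 * Q + 1) * #|edges G|%:R :> R.
Proof.
have := handshake R T; rewrite sum_triangulation.
under eq_bigr do rewrite degree_old.
under [X in _ + X]eq_bigr => e _ do
  under eq_bigr => i _ do rewrite degree_new.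
rewrite -mulr_sumr !handshake !sumr_const card_ord card_edge.
by rewrite -[2 *+ q]mulr_natr -[_ *+ #|edges G|]mulr_natr; lra.
Qed.

Variable rho : G -> G -> R.
Hypothesis rhoP : resistance_matrix rho.

Let a : R := 2 / (Q + 2).

(** For j away from the midpoint of an edge e = uv, eliminating this midpoint,
which has degree 2, makes its resistance to j equal to
(r_uj + r_vj) / 2 + 1 / 2 - r_uv / 4 with the new resistances r; the offset is
the part without j, as the double mean is half of the old resistance of e. *)
Definition midpoint_offset (e : {set G}) : R :=
  2^-1 - a / 2 * edge_mean (fun u => edge_mean (rho u) e) e.

Definition triangulation_resistance (x y : T) : R :=
  match x, y with
  | inl u, inl v => a * rho u v
  | inl u, inr (f, _) => a * edge_mean (rho u) (val f) + midpoint_offset (val f)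
  | inr (e, _), inl v => a * edge_mean (rho v) (val e) + midpoint_offset (val e)
  | inr (e, i), inr (f, j) =>
      a * edge_mean (fun u => edge_mean (rho u) (val f)) (val e)
      + midpoint_offset (val e) + midpoint_offset (val f)
      - ((e, i) == (f, j))%:R
  end.

Lemma edge_mean2C e f :
  edge_mean (fun u => edge_mean (rho u) e) f =
  edge_mean (fun u => edge_mean (rho u) f) e.
Proof.
have [rhoC _ _] := rhoP.
rewrite /edge_mean -!mulr_sumr exchange_big /=; congr (_ * (_ * _)).
by apply: eq_bigr => u _; apply: eq_bigr => v _.
Qed.

(** The q midpoints of an edge uv see the mean of f u and f v, so they act on u
as q more half-edges uv: this multiplies the Laplacian by 1 + q / 2, the
inverse of a. *)
Lemma laplacian_extension (f : T -> R) (kappa : {set G} -> R) :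
    (forall e i, f (inr (e, i)) =
       edge_mean (fun u => f (inl u)) (val e) + kappa (val e)) ->
  (forall u, laplacian f (inl u) =
     (1 + Q / 2) * laplacian (fun v => f (inl v)) u
     - Q * \sum_(e : edge G | u \in val e) kappa (val e))
  /\ (forall e i, laplacian f (inr (e, i)) = 2 * kappa (val e)).
Proof.
move=> fE; split=> [u|e i]; last first.
  rewrite /laplacian sum_triangulation_new sumrB sum_edge_const fE /edge_mean.
  by lra.
rewrite {1}/laplacian sum_triangulation_old.
under [X in _ + X]eq_bigr => e _ do under eq_bigr => i _ do rewrite fE.
under [X in _ + X]eq_bigr => e _ do
  rewrite sumr_const card_ord -mulr_natl -/Q opprD addrA mulrBr.
rewrite [X in _ + X = _]sumrB -!mulr_sumr.
rewrite (sum_incident (fun A => f (inl u) - edge_mean (fun v => f (inl v)) A)).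
rewrite [X in Q * X](_ : _ = 2^-1 * laplacian (fun v => f (inl v)) u).
  by rewrite /laplacian; lra.
rewrite /laplacian mulr_sumr; apply: eq_bigr => v uv.
rewrite /edge_mean big_setU1 /= ?big_set1; first by lra.
by rewrite inE; apply/eqP => uvE; rewrite uvE adj_irrefl in uv.
Qed.

Lemma laplacian_delta (H : sgraph) (x y : H) :
  laplacian (fun z => (z == y)%:R) x =
  (degree x)%:R * (x == y)%:R - (adj x y)%:R :> R.
Proof.
rewrite laplacianE; congr (_ - _); rewrite big_mkcond (bigD1 y) //= eqxx.
by rewrite big1 ?addr0; [case: (adj x y) | move=> z /negbTE ->; case: ifP].
Qed.

(** A new column is the mean of two old columns, up to a constant and a delta
function; this reduces the new columns to the old ones. *)
Lemma triangulation_resistance_new z (f : edge G) i :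
  triangulation_resistance z (inr (f, i)) =
  edge_mean (fun s => triangulation_resistance z (inl s)) (val f)
  + midpoint_offset (val f) - (z == inr (f, i))%:R.
Proof.
case: z => [u|[e j]] /=.
  by rewrite subr0 /edge_mean -mulr_sumr mulrCA.
by rewrite edge_mean_affine edge_mean2C; ring.
Qed.

(** In a new column the terms 2 [x = s] average, over the two ends s, to the
indicator of adjacency to the midpoint; the Laplacian of the delta function at
the midpoint cancels this indicator and leaves 2 at the midpoint itself. *)
Lemma triangulation_resistanceP : resistance_matrix triangulation_resistance.
Proof.
have [rhoC rho0 [c cP]] := rhoP.
have Q0 : Q + 2 != 0 by rewrite -natrD pnatr_eq0 addnS.
split.
- move=> [u|[e i]] [v|[f j]] //=; first by rewrite rhoC.
  by rewrite edge_mean2C eq_sym; ring.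
- move=> [u|[e i]] /=; first by rewrite rho0 mulr0.
  by rewrite eqxx /midpoint_offset /=; lra.
pose c' (x : T) : R := match x with
  | inl u => c u - Q * \sum_(e : edge G | u \in val e) midpoint_offset (val e)
  | inr (e, _) => 2 * midpoint_offset (val e)
  end.
exists c'.
have oldP j x : laplacian (triangulation_resistance ^~ (inl j)) x =
    c' x - 2 * (x == inl j)%:R.
  have colE e i : triangulation_resistance (inr (e, i)) (inl j) =
      edge_mean (fun u => triangulation_resistance (inl u) (inl j)) (val e)
      + midpoint_offset (val e).
    rewrite /= /edge_mean -mulr_sumr mulrCA; congr (_ * (_ * _) + _).
    by apply: eq_bigr => u _; rewrite rhoC.
  have [old new] :=
    @laplacian_extension (triangulation_resistance ^~ (inl j)) _ colE.
  case: x => [u|[e i]]; last by rewrite new /= mulr0 subr0.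
  rewrite old /= (_ : laplacian _ u = a * laplacian (rho ^~ j) u); last first.
    by rewrite /laplacian mulr_sumr; apply: eq_bigr => v _; rewrite mulrBr.
  have -> : (inl u == inl j :> T) = (u == j) by [].
  by rewrite cP /a; field.
move=> x [j|[f j]]; first exact: oldP.
have colE z := triangulation_resistance_new z f j.
transitivity (2^-1 * \sum_(s in val f)
    laplacian (triangulation_resistance ^~ (inl s)) x
    - laplacian (fun z : T => (z == inr (f, j))%:R) x).
  rewrite /laplacian exchange_big mulr_sumr -sumrB; apply: eq_bigr => z _.
  by rewrite !colE /edge_mean sumrB; ring.
under eq_bigr => s _ do rewrite oldP.
rewrite sumrB sum_edge_const -mulr_sumr laplacian_delta.
have -> : \sum_(s in val f) (x == inl s)%:R = (adj x (inr (f, j)))%:R :> R.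
  case: x => [u|[e i]] /=; last by rewrite big1.
  rewrite big_mkcond (bigD1 u) //= eqxx big1 ?addr0; first by case: ifP.
  by move=> s su; rewrite [_ == _](negbTE _) ?if_same // eq_sym.
have [->|_] := eqVneq x (inr (f, j)); last by rewrite !mulr0; lra.
by rewrite degree_new; lra.
Qed.

(** The weight of u after each adjacent midpoint, of weight t, has given u half
of its weight. *)
Definition pushed_weight (w : T -> R) (t : R) (u : G) : R :=
  w (inl u) + Q * t / 2 * (degree u)%:R.

Lemma sum_pushed_weight (w : T -> R) t (f : T -> R) (kappa : {set G} -> R) :
    (forall p, w (inr p) = t) ->
  \sum_(u : G) w (inl u) * f (inl u)
  + \sum_(e : edge G) \sum_(i < q)
      w (inr (e, i)) * (edge_mean (fun u => f (inl u)) (val e) + kappa (val e))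
  = \sum_u pushed_weight w t u * f (inl u)
    + Q * t * \sum_(e : edge G) kappa (val e).
Proof.
move=> wE.
under [X in _ + X]eq_bigr => e _ do under eq_bigr => i _ do rewrite wE.
under [X in _ + X]eq_bigr => e _ do
  rewrite sumr_const card_ord -mulr_natl -/Q mulrDr mulrDr.
rewrite [X in _ + X]big_split /= -!mulr_sumr sum_edge_ends.
under [in RHS]eq_bigr => u _ do rewrite /pushed_weight mulrDl -mulrA.
by rewrite big_split /= -mulr_sumr; ring.
Qed.

(** The rows and then the columns of the midpoints are replaced by means over the
ends of their edges.  The kappa terms collect the offsets, and the last term
comes from the diagonal, where the mean formula exceeds the resistance 0 of a
midpoint to itself by 1. *)
Lemma weighted_sum_triangulation (w1 w2 : T -> R) (t1 t2 : R) :
    (forall p, w1 (inr p) = t1) -> (forall p, w2 (inr p) = t2) ->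
  let m : R := #|edges G|%:R in
  let kappa := \sum_(e : edge G) midpoint_offset (val e) in
  weighted_sum triangulation_resistance w1 w2 =
  a * weighted_sum rho (pushed_weight w1 t1) (pushed_weight w2 t2)
  + Q * kappa * (t1 * (\sum_u w2 (inl u) + Q * m * t2)
                 + t2 * (\sum_u w1 (inl u) + Q * m * t1))
  - Q * m * t1 * t2.
Proof.
move=> w1E w2E m kappa.
have [rhoC _ _] := triangulation_resistanceP.
have sumE (w : T -> R) t : (forall p, w (inr p) = t) ->
    \sum_x w x = \sum_u w (inl u) + Q * m * t.
  move=> wE; rewrite sum_triangulation; congr (_ + _).
  under eq_bigr => e _ do under eq_bigr => i _ do rewrite wE.
  under eq_bigr => e _ do rewrite sumr_const card_ord -mulr_natl.
  by rewrite sumr_const card_edge -[LHS]mulr_natr /m /Q; ring.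
have sum_pushed : \sum_v pushed_weight w2 t2 v = \sum_u w2 (inl u) + Q * m * t2.
  by rewrite big_split -mulr_sumr handshake /m /=; field.
have rowE (w : T -> R) t z : (forall p, w (inr p) = t) ->
    \sum_y w y * triangulation_resistance z y =
    \sum_v pushed_weight w t v * triangulation_resistance z (inl v)
    + Q * t * kappa - t * (if z is inr _ then 1 else 0).
  move=> wE; rewrite sum_triangulation.
  under [X in _ + X]eq_bigr => e _ do under eq_bigr => i _ do
    rewrite triangulation_resistance_new mulrBr.
  under [X in _ + X]eq_bigr => e _ do rewrite sumrB.
  rewrite [X in _ + X]sumrB addrA.
  rewrite (sum_pushed_weight (triangulation_resistance z) _ wE).
  congr (_ - _).
  rewrite pair_big /=; case: z => [u|z].
    by rewrite mulr0 big1 // => p _; rewrite mulr0.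
  rewrite mulr1 -[RHS](wE z) -[RHS](sum_delta (fun p => w (inr p))).
  by apply: eq_bigr => -[e i] _; rewrite eq_sym.
have oldE v : \sum_x w1 x * triangulation_resistance x (inl v) =
    a * (\sum_u pushed_weight w1 t1 u * rho u v) + Q * t1 * kappa.
  under eq_bigr => x _ do rewrite rhoC.
  rewrite (rowE _ _ _ w1E) mulr0 subr0 mulr_sumr; congr (_ + _).
  by apply: eq_bigr => u _; rewrite rhoC mulrCA.
have newE : \sum_(x : T) w1 x * (if x is inr _ then 1 else 0) = Q * m * t1.
  rewrite sum_triangulation big1 ?add0r => [|u _]; last by rewrite mulr0.
  under eq_bigr => e _ do under eq_bigr => i _ do rewrite mulr1 w1E.
  under eq_bigr => e _ do rewrite sumr_const card_ord -mulr_natl.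
  by rewrite sumr_const card_edge -[LHS]mulr_natr /m /Q; ring.
rewrite /weighted_sum.
transitivity (\sum_x (\sum_v pushed_weight w2 t2 v *
      (w1 x * triangulation_resistance x (inl v))
    + w1 x * (Q * t2 * kappa)
    - t2 * (w1 x * (if x is inr _ then 1 else 0)))).
  apply: eq_bigr => x _; under eq_bigr => y _ do rewrite -mulrA.
  rewrite -mulr_sumr (rowE _ _ _ w2E) mulrBr mulrDr mulr_sumr.
  rewrite [w1 x * (t2 * _)]mulrCA.
  by congr (_ + _ - _); apply: eq_bigr => v _; rewrite mulrCA.
rewrite sumrB big_split /= exchange_big /= -mulr_suml -mulr_sumr newE.
under eq_bigr => v _ do rewrite -mulr_sumr oldE mulrDr.
rewrite big_split /= -mulr_suml sum_pushed (sumE w1 t1) //.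
have -> : \sum_x \sum_y pushed_weight w1 t1 x * pushed_weight w2 t2 y * rho x y
    = \sum_v pushed_weight w2 t2 v * (\sum_u pushed_weight w1 t1 u * rho u v).
  rewrite exchange_big; apply: eq_bigr => v _; rewrite mulr_sumr.
  by apply: eq_bigr => u _; ring.
under eq_bigr => v _ do rewrite mulrCA.
by rewrite -mulr_sumr; ring.
Qed.

End Triangulation.

(** * The Kirchhoff indices and their recursion *)

Section WeightedSums.
Variables (R : realType) (G : sgraph) (rho : G -> G -> R).
Hypothesis rhoP : resistance_matrix rho.
Let one : G -> R := fun=> 1.
Let d : G -> R := fun u => (degree u)%:R.

Lemma weighted_sumC w1 w2 : weighted_sum rho w1 w2 = weighted_sum rho w2 w1.
Proof.
have [rhoC _ _] := rhoP.
rewrite /weighted_sum exchange_big; apply: eq_bigr => x _.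
by apply: eq_bigr => y _; rewrite rhoC; ring.
Qed.

Lemma weighted_sum_linear b c f g w :
  weighted_sum rho (fun u => b * f u + c * g u) w =
  b * weighted_sum rho f w + c * weighted_sum rho g w.
Proof.
rewrite /weighted_sum !mulr_sumr -big_split; apply: eq_bigr => x _.
rewrite !mulr_sumr -big_split; apply: eq_bigr => y _ /=; ring.
Qed.

Lemma pair_sumE (F : G -> G -> R) :
  (forall x y, F x y = F y x) -> (forall x, F x x = 0) ->
  \sum_x \sum_y F x y = 2 * pair_sum F.
Proof.
move=> FC F0.
have -> : 2 * pair_sum F = pair_sum F +
    \sum_x \sum_(y | (enum_rank y < enum_rank x)%N) F x y.
  rewrite mulrDl mul1r; congr (_ + _).
  rewrite /pair_sum (exchange_big_dep xpredT) //=.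
  by apply: eq_bigr => x _; apply: eq_bigr => y _; rewrite FC.
rewrite /pair_sum -big_split; apply: eq_bigr => x _ /=.
rewrite (bigID (fun y => (enum_rank x < enum_rank y)%N)) /=; congr (_ + _).
rewrite (bigD1 x) ?ltnn //= F0 add0r; apply: eq_bigl => y.
rewrite -leqNgt [RHS]ltn_neqAle andbC; congr (_ && _); congr (~~ _).
by apply/eqP/eqP => [-> //|/val_inj/enum_rank_inj].
Qed.

Lemma multiplicative_kirchhoffE :
  weighted_sum rho d d = 2 * multiplicative_kirchhoff R G.
Proof.
have [rhoC rho0 _] := rhoP.
rewrite -pair_sumE => [|x y|x]; rewrite ?resistance_matrixE //.
- apply: eq_bigr => x _; apply: eq_bigr => y _.
  by rewrite (resistance_matrixE rhoP) natrM.
- by rewrite !(resistance_matrixE rhoP) rhoC mulnC.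
- by rewrite !(resistance_matrixE rhoP) rho0 mulr0.
Qed.

Lemma additive_kirchhoffE :
  weighted_sum rho d one = additive_kirchhoff R G.
Proof.
have [rhoC rho0 _] := rhoP.
apply: (@mulfI _ 2); first by rewrite pnatr_eq0.
rewrite -pair_sumE => [|x y|x].
- rewrite mulrDl mul1r {2}weighted_sumC /weighted_sum -big_split.
  apply: eq_bigr => x _; rewrite -big_split; apply: eq_bigr => y _ /=.
  by rewrite (resistance_matrixE rhoP) natrD /one /d; ring.
- by rewrite !(resistance_matrixE rhoP) rhoC addnC.
- by rewrite !(resistance_matrixE rhoP) rho0 mulr0.
Qed.

Lemma kirchhoffE : weighted_sum rho one one = 2 * kirchhoff R G.
Proof.
have [rhoC rho0 _] := rhoP.
rewrite -pair_sumE => [|x y|x].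
- apply: eq_bigr => x _; apply: eq_bigr => y _ /=.
  by rewrite (resistance_matrixE rhoP) /one; ring.
- by rewrite !(resistance_matrixE rhoP) rhoC.
- by rewrite !(resistance_matrixE rhoP) rho0.
Qed.

Lemma kemeny_kirchhoff (i : G) : kemeny R i =
  (multiplicative_kirchhoff R G / (2 * #|edges G|%:R))%:E.
Proof.
rewrite (kemenyE i rhoP) -/(weighted_sum rho d d) multiplicative_kirchhoffE.
congr (_%:E); rewrite !invfM; lra.
Qed.

Variable q : nat.
Let Q : R := q%:R.
Let a : R := 2 / (Q + 2).
Let T := triangulation q G.
Let rho' := @triangulation_resistance R q G rho.
Let one' : T -> R := fun=> 1.
Let d' : T -> R := fun u => (degree u)%:R.
Let n : R := #|G|%:R.
Let m : R := #|edges G|%:R.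
Let kappa : R := m / 2 - a / 4 * (n - 1).

Lemma sum_midpoint_offset : G ->
  \sum_(e : edge G) midpoint_offset q rho (val e) = kappa.
Proof.
have [rhoC rho0 _] := rhoP.
move=> i; rewrite sumrB -mulr_sumr sum_edge_mean2 // (foster rhoP i).
rewrite sumr_const card_edge -[_ *+ _]mulr_natr /kappa /m /n /a -/Q; lra.
Qed.

Lemma pushed_weight1 u : pushed_weight one' 1 u = 1 * one u + Q / 2 * d u.
Proof. by rewrite /pushed_weight /one' /one -/Q; lra. Qed.

Lemma pushed_weight_degree u :
  pushed_weight d' 2 u = (2 * Q + 1) * d u + 0 * d u.
Proof. by rewrite /pushed_weight /d' degree_old -/Q /d; lra. Qed.

(** The weights 1 and d become 1 + q d / 2 and (2 q + 1) d when the midpoints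
pass their weights on, so the three sums are closed under the recursion. *)
Lemma triangulation_sums (i : G) :
  [/\ weighted_sum rho' one' one' =
        a * (weighted_sum rho one one + Q * weighted_sum rho d one
             + Q ^+ 2 / 4 * weighted_sum rho d d)
        + 2 * Q * kappa * (n + Q * m) - Q * m,
      weighted_sum rho' d' one' =
        a * (2 * Q + 1) * (weighted_sum rho d one + Q / 2 * weighted_sum rho d d)
        + 2 * Q * kappa * (n + (3 * Q + 1) * m) - 2 * Q * m
    & weighted_sum rho' d' d' =
        a * (2 * Q + 1) ^+ 2 * weighted_sum rho d d
        + 8 * Q * kappa * (2 * Q + 1) * m - 4 * Q * m].
Proof.
have one'E p : one' (inr p) = 1 by [].
have d'E p : d' (inr p) = 2 by case: p => e j; rewrite /d' degree_new.
have E1 : pushed_weight one' 1 = fun u => 1 * one u + Q / 2 * d u.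
  by apply/funext => u; exact: pushed_weight1.
have E2 : pushed_weight d' 2 = fun u => (2 * Q + 1) * d u + 0 * d u.
  by apply/funext => u; exact: pushed_weight_degree.
have sum1 : \sum_(u : G) one' (inl u) = n by rewrite sumr_const.
have sumd : \sum_(u : G) d' (inl u) = (Q + 1) * (2 * m).
  by under eq_bigr do rewrite /d' degree_old; rewrite -mulr_sumr handshake.
have wC := weighted_sumC; have wL := weighted_sum_linear.
split.
- apply: etrans (weighted_sum_triangulation rhoP one'E one'E) _.
  rewrite sum_midpoint_offset //.
  by rewrite E1 sum1 wL !(wC _ (fun u => _ + _)) !wL (wC one d) -/a -/m -/Q; field.
- apply: etrans (weighted_sum_triangulation rhoP d'E one'E) _.
  rewrite sum_midpoint_offset //.
  rewrite E1 E2 sum1 sumd wL !(wC _ (fun u => _ + _)) !wL (wC one d) -/a -/m -/Q.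
  by field.
- apply: etrans (weighted_sum_triangulation rhoP d'E d'E) _.
  rewrite sum_midpoint_offset //.
  by rewrite E2 sumd wL !(wC _ (fun u => _ + _)) !wL -/a -/m -/Q; field.
Qed.

End WeightedSums.

(** * The triangle *)

Section CompleteGraph3.
Variable R : realType.
Let K3 := complete_graph 3.

(** An edge in parallel with the path of length 2 through the third node. *)
Definition complete_resistance (x y : K3) : R := 2 / 3 * (x != y)%:R.

Lemma degree_K3 (x : K3) : degree x = 2.
Proof.
rewrite /degree (_ : [set y | adj x y] = [set~ x]) ?cardsC1 ?card_ord //.
by apply/setP => y; rewrite !inE eq_sym.
Qed.

Lemma card_edges_K3 : #|edges K3| = 3%N.
Proof.
have := handshake R K3; under eq_bigr do rewrite degree_K3.
rewrite sumr_const card_ord => edgesE.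
by apply/eqP; rewrite -(eqr_nat R); apply/eqP; lra.
Qed.

Lemma sum_complete_resistance (j : K3) : \sum_x complete_resistance x j = 4 / 3.
Proof.
rewrite /complete_resistance -mulr_sumr (bigD1 j) //= eqxx add0r.
under eq_bigr => x xj do rewrite xj.
by rewrite sumr_const cardC1 card_ord /=; lra.
Qed.

Lemma complete_resistanceP : resistance_matrix complete_resistance.
Proof.
split.
- by move=> x y; rewrite /complete_resistance eq_sym.
- by move=> x; rewrite /complete_resistance eqxx mulr0.
exists (fun=> 2 / 3) => x j.
rewrite laplacianE degree_K3.
have := sum_complete_resistance j; rewrite (bigD1 x) //=.
rewrite (eq_bigl (adj x)) => [|y]; last by rewrite /= /complete_adj eq_sym.
by rewrite /complete_resistance; case: (x == j) => /=; lra.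
Qed.

Lemma weighted_sum_K3 b c :
  weighted_sum complete_resistance (fun=> b) (fun=> c) = 4 * b * c.
Proof.
rewrite /weighted_sum exchange_big.
under eq_bigr => y _ do rewrite -mulr_sumr sum_complete_resistance.
by rewrite sumr_const card_ord; lra.
Qed.

End CompleteGraph3.

(** * Closed forms for the web *)

Section Web.
Variables (R : realType) (q : nat).
Let Q : R := q%:R.

(** The first sum counts every unordered pair twice, and so does the last one;
X / (2 Q + 1) stands for (2 Q + 1)^(k - 1), including k = 0. *)
Lemma web_indices k :
  let N := pseudofractal_web q k in
  let X := (2 * Q + 1) ^+ k in
  let Y := (2 / (Q + 2)) ^+ k in
  let d (u : N) : R := (degree u)%:R in
  exists rho : N -> N -> R,
  [/\ resistance_matrix rho,
      (#|N|%:R = 3 / 2 * (X + 1) :> R /\ #|edges N|%:R = 3 * X :> R),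
      weighted_sum rho d d =
        2 * (9 * (2 * Q + 3) / (2 * Q + 1) * X ^+ 2
        - 6 * (Q + 4) / (2 * Q + 1) * (X ^+ 2 * Y)
        + (4 * Q + 5) * (X / (2 * Q + 1))),
      weighted_sum rho d (fun=> 1) =
        9 * (2 * Q + 3) * (6 * Q + 11) / (4 * (2 * Q + 1) * (2 * Q + 5)) * X ^+ 2
        - 3 * (Q + 4) / (2 * Q + 1) * (X ^+ 2 * Y)
        + 3 * (Q + 4) / (2 * Q + 5) * (X * Y)
        + (4 * Q + 5) / 2 * (X / (2 * Q + 1))
        + 1 / 4
    & weighted_sum rho (fun=> 1) (fun=> 1) =
        2 * (9 * (2 * Q + 3) ^+ 2 / (8 * (2 * Q + 1) * (2 * Q + 5)) * X ^+ 2
        - 3 * (Q + 4) / (8 * (2 * Q + 1)) * (X ^+ 2 * Y)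
        + 3 * (Q + 4) / (4 * (2 * Q + 5)) * (X * Y)
        + (Q + 1) * (4 * Q + 5) / (2 * (2 * Q + 5)) * (X / (2 * Q + 1))
        + 5 * (Q + 4) / (8 * (2 * Q + 5)) * Y
        - 1 / 8)].
Proof.
have Q0 : 0 <= Q by exact: ler0n.
have Q1 : 2 * Q + 1 != 0 by lra.
have Q2 : Q + 2 != 0 by lra.
have Q5 : 2 * Q + 5 != 0 by lra.
elim: k => [|k [rho [rhoP [nE mE] dd d1 oo]]].
  exists (@complete_resistance R); rewrite !expr0.
  have dE : (fun u : complete_graph 3 => (degree u)%:R) = fun=> 2 :> R.
    by apply/funext => u; rewrite degree_K3.
  have wE := @weighted_sum_K3 R; rewrite /= dE !wE.
  split; [exact: complete_resistanceP| |field..]; rewrite ?Q1 ?Q5 //.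
  by rewrite card_ord (card_edges_K3 R); split; lra.
exists (@triangulation_resistance R q _ rho).
have [i0 _] : exists i0, i0 \in pseudofractal_web q k.
  apply/card_gt0P; rewrite -(ltr_nat R) nE.
  by have : 0 <= (2 * Q + 1) ^+ k; [apply: exprn_ge0|]; lra.
have [oo' d1' dd'] := triangulation_sums rhoP q i0.
split; first exact: triangulation_resistanceP.
- rewrite card_triangulation card_edges_triangulation nE mE -/Q exprS.
  by split; field.
- rewrite dd' dd nE mE -/Q !exprS; field; rewrite ?Q1 ?Q2 ?Q5 //.
- rewrite d1' d1 dd nE mE -/Q !exprS; field; rewrite ?Q1 ?Q2 ?Q5 //.
- rewrite oo' oo d1 dd nE mE -/Q !exprS; field; rewrite ?Q1 ?Q2 ?Q5 //.
Qed.

End Web.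

Theorem mainTheorem12 (R : realType) (q k : nat) (hq : (1 <= q)%N) :
  let Q : R := q%:R in
  let N := pseudofractal_web q k in
  [/\ forall i : N, kemeny R i =
        (3 * (2 * Q + 3) * (2 * Q + 1) ^ (k%:Z - 1) / 2
         - (Q + 4) / (2 * Q + 1) * ((4 * Q + 2) / (Q + 2)) ^+ k
         + (4 * Q + 5) / (6 * (2 * Q + 1)))%:E,
      multiplicative_kirchhoff R N =
        9 * (2 * Q + 3) / (2 * Q + 1) * (2 * Q + 1) ^+ (2 * k)
        - 6 * (Q + 4) / (2 * Q + 1) * (2 * (2 * Q + 1) ^+ 2 / (Q + 2)) ^+ k
        + (4 * Q + 5) * (2 * Q + 1) ^ (k%:Z - 1),
      additive_kirchhoff R N =
        9 * (2 * Q + 3) * (6 * Q + 11) / (4 * (2 * Q + 1) * (2 * Q + 5))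
          * (2 * Q + 1) ^+ (2 * k)
        - 3 * (Q + 4) / (2 * Q + 1) * (2 * (2 * Q + 1) ^+ 2 / (Q + 2)) ^+ k
        + 3 * (Q + 4) / (2 * Q + 5) * (2 * (2 * Q + 1) / (Q + 2)) ^+ k
        + (4 * Q + 5) / 2 * (2 * Q + 1) ^ (k%:Z - 1)
        + 1 / 4
    & kirchhoff R N =
        9 * (2 * Q + 3) ^+ 2 / (8 * (2 * Q + 1) * (2 * Q + 5))
          * (2 * Q + 1) ^+ (2 * k)
        - 3 * (Q + 4) / (8 * (2 * Q + 1))
          * (2 * (2 * Q + 1) ^+ 2 / (Q + 2)) ^+ k
        + 3 * (Q + 4) / (4 * (2 * Q + 5)) * (2 * (2 * Q + 1) / (Q + 2)) ^+ k
        + (Q + 1) * (4 * Q + 5) / (2 * (2 * Q + 5)) * (2 * Q + 1) ^ (k%:Z - 1)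
        + 5 * (Q + 4) / (8 * (2 * Q + 5)) * (2 / (Q + 2)) ^+ k
        - 1 / 8].
Proof.
move=> Q N.
have Q0 : 0 <= Q by exact: ler0n.
have Q1 : 2 * Q + 1 != 0 by lra.
have Q2 : Q + 2 != 0 by lra.
have Q5 : 2 * Q + 5 != 0 by lra.
have X0 : (2 * Q + 1) ^+ k != 0 by rewrite expf_neq0.
have [rho [rhoP [_ mE] dd d1 oo]] := web_indices R q k.
have mult : multiplicative_kirchhoff R N = 2^-1 *
    weighted_sum rho (fun u => (degree u)%:R) (fun u => (degree u)%:R).
  by rewrite (multiplicative_kirchhoffE rhoP); lra.
have addi := additive_kirchhoffE rhoP.
have kirch : kirchhoff R N = 2^-1 * weighted_sum rho (fun=> 1) (fun=> 1).
  by rewrite (kirchhoffE rhoP); lra.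
have expX : (2 * Q + 1) ^ (k%:Z - 1) = (2 * Q + 1) ^+ k / (2 * Q + 1).
  by rewrite expfzDr.
have expX2 : (2 * Q + 1) ^+ (2 * k) = ((2 * Q + 1) ^+ k) ^+ 2.
  by rewrite mulnC exprM.
have expXY : (2 * (2 * Q + 1) / (Q + 2)) ^+ k =
    (2 * Q + 1) ^+ k * (2 / (Q + 2)) ^+ k.
  by rewrite -exprMn; congr (_ ^+ k); ring.
have expXXY : (2 * (2 * Q + 1) ^+ 2 / (Q + 2)) ^+ k =
    ((2 * Q + 1) ^+ k) ^+ 2 * (2 / (Q + 2)) ^+ k.
  by rewrite exprAC -exprMn; congr (_ ^+ k); ring.
split.
- move=> i; rewrite (kemeny_kirchhoff rhoP) mult dd mE expX; congr (_%:E).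
  have -> : (4 * Q + 2) / (Q + 2) = 2 * (2 * Q + 1) / (Q + 2) by ring.
  by rewrite expXY; field; rewrite Q1 X0.
- by rewrite mult dd expX expX2 expXXY; field.
- by rewrite -addi d1 expX expX2 expXXY expXY; ring.
- by rewrite kirch oo expX expX2 expXXY expXY; field; rewrite Q1 Q5.
Qed.
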